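(* Let $\mathcal V$ be a set of consecutive integers in $\mathbb N_0$ with at least two elements, and let $\mathcal V^0=\mathcal V\setminus\{\max\mathcal V\}$ if $\mathcal V$ is bounded above, $\mathcal V^0=\mathcal V$ otherwise. Let $(W^{(\lambda)})_{\lambda\in\mathcal V}$ be a family of weights, and assume there are families of matrix polynomials $(\Phi^{(\lambda)})_{\lambda\in\mathcal V^0}$, $(\Psi^{(\lambda)})_{\lambda\in\mathcal V^0}$ with $\deg\Phi^{(\lambda)}\le2$, $\deg\Psi^{(\lambda)}\le1$, such that $$W^{(\lambda+1)}(x)=W^{(\lambda)}(x)\Phi^{(\lambda)}(x),\qquad (W^{(\lambda+1)}\cdot\nabla)(x)=W^{(\lambda)}(x)\Psi^{(\lambda)}(x),\qquad\forall\lambda\in\mathcal V^0,$$ with $\Phi^{(\lambda)}(x)=\mathcal K_2^{(\lambda)}x^2+\mathcal K_1^{(\lambda)}x+\mathcal K_0^{(\lambda)}$ and $\Psi^{(\lambda)}(x)=\mathcal J_1^{(\lambda)}x+\mathcal J_0^{(\lambda)}$. Then for every $\lambda\in\mathcal V^0$: (1) The difference operator $\Delta=\eta-I$ is a backward shift operator $\Delta:L^2(W^{(\lambda)})\to L^2(W^{(\lambda+1)})$ for $P_n^{(\lambda)}$: $(P_n^{(\lambda)}\cdot\Delta)(x)=nP_{n-1}^{(\lambda+1)}(x)$. (2) $\Delta$ has an adjoint $S^{(\lambda)}:L^2(W^{(\lambda+1)})\to L^2(W^{(\lambda)})$ given explicitly by $$S^{(\lambda)}=-\bigl(\nabla\Phi^{(\lambda)}(x)^*+\eta^{-1}\Psi^{(\lambda)}(x)^*\bigr)=-\Phi^{(\lambda)}(x)^*+\eta^{-1}\bigl(\Phi^{(\lambda)}(x)^*-\Psi^{(\lambda)}(x)^*\bigr),$$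 such that $\langle P\cdot\Delta,Q\rangle^{(\lambda+1)}=\langle P,Q\cdot S^{(\lambda)}\rangle^{(\lambda)}$ for all matrix polynomials $P,Q$. (3) $S^{(\lambda)}$ is a forward shift operator: for $n\ge1$, $$P_{n-1}^{(\lambda+1)}\cdot S^{(\lambda)}=G_n^{(\lambda)}P_n^{(\lambda)},\qquad G_n^{(\lambda)}=-(n-1)\mathcal K_2^{(\lambda)*}-\mathcal J_1^{(\lambda)*}.$$
   Context: $\mathbb N_0=\{0,1,2,\dots\}$, $N\ge1$ fixed. A weight is $W:\mathbb Z\to M_N(\mathbb C)$ with $W(x)$ positive definite for $x\in\mathbb N_0$, $W(x)=0$ for $x<0$, and finite moments of all orders. For the weight $W^{(\lambda)}$, $\langle P,Q\rangle^{(\lambda)}=\sum_{x=0}^\infty P(x)W^{(\lambda)}(x)Q(x)^*$, and $(P_n^{(\lambda)})_n$ are the monic matrix valued orthogonal polynomials with $\deg P_n^{(\lambda)}=n$ (and $P^{(\lambda)}_{-1}=0$). $L^2(W^{(\lambda)})$ is the space of matrix functions $F$ with $\langle F,F\rangle^{(\lambda)}<\infty$; the operators $\Delta$ and $S^{(\lambda)}$ are considered on matrix polynomials inside these spaces. Difference operators act from the right: $(P\cdot\eta^j)(x)=P(x+j)$, $(P\cdot\eta^jF(x))(x)=P(x+j)F(x)$, $(P\cdot\Delta)(x)=P(x+1)-P(x)$, $(P\cdot\nabla)(x)=P(x)-P(x-1)$. Thus $(Q\cdot S^{(\lambda)})(x)=-Q(x)\Phi^{(\lambda)}(x)^*+Q(x-1)(\Phi^{(\lambda)}(x)^*-\Psi^{(\lambda)}(x)^*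 )$. For a matrix polynomial $\Phi(x)=\sum_kC_kx^k$, $\Phi(x)^*=\sum_kC_k^*x^k$. *)

(* Defs.v *)
From HB Require Import structures.
From mathcomp Require Import all_boot all_order all_algebra complex.
From mathcomp Require Import all_classical all_reals all_analysis.

Set Implicit Arguments.
Unset Strict Implicit.
Unset Printing Implicit Defensive.

Import Order.TTheory GRing.Theory Num.Theory numFieldNormedType.Exports.

Local Open Scope classical_set_scope.
Local Open Scope ring_scope.
Local Open Scope sesquilinear_scope.

(* Matrices have size N.+1, so that the size is at least 1 and ['M[C]_N.+1]
   is a nontrivial ring (required by [{poly _}]).  [A^t*] is the conjugate
   transpose.  Infinite sums are limits in the normed space of matrices. *)

Section IndexSet.

Definition consecutive (V : set nat) : Prop :=
  forall a b c : nat, V a -> V b -> (a <= c <= b)%N -> V c.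

(* An element of V that is an upper bound of V is its maximum; when V is
   unbounded, [ubound V] is empty and nothing is removed. *)
Definition without_max (V : set nat) : set nat := V `\` ubound V.

End IndexSet.

Section Weights.
Variables (C : numClosedFieldType) (N : nat).
Local Notation M := 'M[C]_N.+1.
Implicit Types (W F G A : int -> M) (P Phi Psi : {poly M}).

Definition posdefmx (A : M) : Prop :=
  A \is hermsymmx /\
  forall u : 'rV[C]_N.+1, u != 0 -> 0 < (u *m A *m u^t*) 0 0.

Definition finite_moments W : Prop :=
  forall k : nat, cvgn (series (fun x : nat => (x%:R ^+ k) *: W x%:Z)).

Definition weight W : Prop :=
  [/\ forall x : nat, posdefmx (W x%:Z),
      forall x : int, x < 0 -> W x = 0
    & finite_moments W].

Definition inner W F G : M :=
  limn (series (fun x : nat => F x%:Z *m W x%:Z *m (G x%:Z)^t*)).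

Definition L2 W F : Prop :=
  cvgn (series (fun x : nat => F x%:Z *m W x%:Z *m (F x%:Z)^t*)).

Definition pfun P : int -> M := fun x => P.[x%:~R].

(* The coefficientwise adjoint, P(x)^* = \sum_k (C_k)^* x^k. *)
Definition padj P : {poly M} := map_poly (fun A : M => A^t*) P.

Definition monic_MVOP W (P : nat -> {poly M}) : Prop :=
  (forall n : nat, P n \is monic /\ size (P n) = n.+1) /\
  (forall m n : nat, m != n -> inner W (pfun (P m)) (pfun (P n)) = 0).

(* P_{n-1}, with the convention P_{-1} = 0. *)
Definition prevP (P : nat -> {poly M}) (n : nat) : {poly M} :=
  if n is m.+1 then P m else 0.

(* Difference operators act from the right: [T F] stands for F . T, and
   [rmulop T A] is the operator T A(x), that is F |-> ((F . T)(x)) A(x). *)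
Definition eta_pow (j : int) F : int -> M := fun x => F (x + j).

Definition Delta F : int -> M := fun x => F (x + 1) - F x.

Definition nabla F : int -> M := fun x => F x - F (x - 1).

Definition rmulop (T : (int -> M) -> (int -> M)) A F : int -> M :=
  fun x => T F x *m A x.

Definition Sop Phi Psi F : int -> M :=
  fun x => - (rmulop nabla (pfun (padj Phi)) F x +
              rmulop (eta_pow (-1)) (pfun (padj Psi)) F x).

(* T, defined on matrix polynomials, is an operator L2(W) -> L2(W'): it sends
   polynomials, which are in L2(W), to polynomials, which are in L2(W'). *)
Definition poly_operator W W' (T : (int -> M) -> (int -> M)) : Prop :=
  forall P, L2 W (pfun P) /\
    exists Q : {poly M}, T (pfun P) =1 pfun Q /\ L2 W' (T (pfun P)).

End Weights.

(* Main.v *)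
Require Import Defs.
From HB Require Import structures.
From mathcomp Require Import all_boot all_order all_algebra complex.
From mathcomp Require Import all_classical all_reals all_analysis.
Import Order.TTheory GRing.Theory Num.Theory numFieldNormedType.Exports.
Local Open Scope classical_set_scope.
Local Open Scope ring_scope.
Local Open Scope sesquilinear_scope.

(** The three claims rest on one identity, the adjoint relation
    <P Delta, Q>' = <P, Q S>, where ' marks the objects at l + 1.  It is a
    summation by parts ([inner_Delta_Sop]): the Pearson equations W' = W Phi and
    W' nabla = W Psi turn the weight W on the right hand side into W'(x) and
    W'(x-1), and the boundary terms disappear because W' vanishes at -1 and a
    convergent series has terms tending to 0.

    The rest is a degree count together with the uniqueness of orthogonal
    polynomials.  Delta lowers the degree by one ([Delta_poly]) and S raises it
    by at most one ([Sop_poly]), with known effect on the top coefficient.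
    Hence P_n Delta is orthogonal, for W', to all polynomials of degree less
    than n - 1, and P'_(n-1) S is orthogonal, for W, to all polynomials of
    degree less than n.  A polynomial of degree at most k that is orthogonal to
    all lower degrees is its coefficient of x^k times the monic orthogonal
    polynomial of degree k: the remainder is orthogonal to itself, and
    the inner product is definite on polynomials because the weight is positive
    definite at every natural number ([inner_self_eq0]).  The top coefficients
    are n for P_n Delta and G_n for P'_(n-1) S.

    All series converge because, for polynomials, they are finite combinations
    of the moment series ([is_cvg_inner]). *)

Section ShiftOperators.
Variables (C : numClosedFieldType) (N : nat).
Local Notation M := 'M[C]_N.+1.
Implicit Types (p q : {poly M}) (A B : M).

(** * Matrix polynomials as functions and their adjoints *)

Lemma pfunD p q x : pfun (p + q) x = pfun p x + pfun q x.
Proof. by rewrite /pfun hornerD. Qed.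

Lemma pfunB p q x : pfun (p - q) x = pfun p x - pfun q x.
Proof. by rewrite /pfun hornerD hornerN. Qed.

(** Evaluation is not multiplicative over a noncommutative ring in general;
    it is here because the evaluation points are integers, hence central. *)
Lemma pfunM p q x : pfun (p * q) x = pfun p x *m pfun q x.
Proof.
rewrite /pfun hornerM_comm //; apply: comm_coef_poly => i.
exact: commr_int.
Qed.

Lemma pfunC A x : pfun A%:P x = A.
Proof. exact: hornerC. Qed.

Lemma conjmxM m n k (A : 'M[C]_(m, n)) (B : 'M[C]_(n, k)) :
  (A *m B)^t* = B^t* *m A^t*.
Proof. by rewrite trmx_mul map_mxM. Qed.

Lemma conjmxD m n (A B : 'M[C]_(m, n)) : (A + B)^t* = A^t* + B^t*.
Proof. by rewrite raddfD /= map_mxD. Qed.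

Lemma conjmxN m n (A : 'M[C]_(m, n)) : (- A)^t* = - A^t*.
Proof. by rewrite raddfN /= map_mxN. Qed.

Lemma conjmxB m n (A B : 'M[C]_(m, n)) : (A - B)^t* = A^t* - B^t*.
Proof. by rewrite conjmxD conjmxN. Qed.

Lemma conjmx0 m n : (0 : 'M[C]_(m, n))^t* = 0.
Proof. by rewrite trmx0 map_mx0. Qed.

Lemma coef_padj p k : (padj p)`_k = (p`_k)^t*.
Proof. by rewrite coef_map_id0 // conjmx0. Qed.

Lemma size_padj p n : (size p <= n)%N -> (size (padj p) <= n)%N.
Proof.
move=> sp; apply/leq_sizeP => j nj.
by rewrite coef_padj nth_default ?conjmx0 // (leq_trans sp).
Qed.

Lemma pfun_sum p n (x : nat) : (size p <= n)%N ->
  pfun p x = \sum_(i < n) (x%:R ^+ i) *: p`_i.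
Proof.
move=> sp; rewrite /pfun (horner_coef_wide _ sp); apply: eq_bigr => i _.
by rewrite -[in LHS]pmulrn -[in LHS]natrX mulr_natr -natrX scaler_nat.
Qed.

Lemma conj_sum n (F : 'I_n -> M) : (\sum_i F i)^t* = \sum_i (F i)^t*.
Proof.
by apply: (big_morph (fun A : M => A^t*)); [exact: conjmxD | exact: conjmx0].
Qed.

Lemma conj_scalenat A (n : nat) k : (n%:R ^+ k *: A)^t* = n%:R ^+ k *: A^t*.
Proof. by rewrite linearZ /= map_mxZ rmorphXn /= rmorph_nat. Qed.

(** Needs the point to be real: then conjugation leaves the powers of x alone
    and acts on the coefficients only. *)
Lemma conj_pfun p (x : nat) : (pfun p x)^t* = pfun (padj p) x.
Proof.
rewrite (pfun_sum _ _ _ (leqnn (size p))).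
rewrite (pfun_sum _ _ _ (size_padj _ _ (leqnn (size p)))).
by rewrite conj_sum; apply: eq_bigr => i _; rewrite conj_scalenat coef_padj.
Qed.

Lemma padjK p : padj (padj p) = p.
Proof. by apply/polyP => k; rewrite !coef_padj trmxCK. Qed.

(** * Degrees and top coefficients *)

Lemma size_polyM_le (R : nzSemiRingType) (p q : {poly R}) a b :
  (size p <= a)%N -> (size q <= b.+1)%N -> (size (p * q)%R <= a + b)%N.
Proof.
move=> sp sq; rewrite (leq_trans (size_polyMleq _ _)) //.
by rewrite -[(a + b)%N]/(a + b).+1.-1 -addnS -!subn1 leq_sub2r // leq_add.
Qed.

(** Bounds on the sizes, rather than exact degrees, because leading matrix
    coefficients may multiply to zero or be zero themselves. *)
Lemma coefM_top (R : nzSemiRingType) (p q : {poly R}) a b :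
  (size p <= a.+1)%N -> (size q <= b.+1)%N -> (p * q)`_(a + b) = p`_a * q`_b.
Proof.
move=> sp sq; rewrite coefM.
have ia : (a < (a + b).+1)%N by rewrite ltnS leq_addr.
rewrite (bigD1 (Ordinal ia)) //= addKn big1 ?addr0 // => i ni.
have [ia'|ai|e] := ltngtP i a.
- rewrite [q`_ _]nth_default ?mulr0 // (leq_trans sq) //.
  by rewrite ltn_subRL ltn_add2r.
- by rewrite [p`_ _]nth_default ?mul0r // (leq_trans sp).
- by move: ni; rewrite -val_eqE /= e eqxx.
Qed.

(** One step of division by a monic polynomial of the same formal degree: this
    is how an expansion in monic orthogonal polynomials starts. *)
Lemma poly_split_top p q n : q \is monic -> size q = n.+1 ->
  (size p <= n.+1)%N -> exists r, p = (p`_n)%:P * q + r /\ (size r <= n)%N.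
Proof.
move=> mq sq sp; exists (p - (p`_n)%:P * q); split.
  by rewrite addrC subrK.
apply/leq_sizeP => j nj; rewrite coefB coefCM.
have [<-|jn] := eqVneq n j.
  have := monicP mq; rewrite /lead_coef sq /= => ->.
  by rewrite mulr1 subrr.
have lj : (n < j)%N by rewrite ltn_neqAle jn.
rewrite [p`_j]nth_default; last exact: leq_trans lj.
by rewrite [q`_j]nth_default ?sq // mulr0 subr0.
Qed.

(** The discrete analogue of differentiation: a difference lowers the degree by
    one and multiplies the top coefficient by n c.  Writing p = a + r X gives
    p(x+c) - p(x) = (r(x+c) - r(x)) (x + c) + r(x) c, whence an induction on the
    degree.  When n = 0, [q`_n.-1] is [q`_0] and both sides vanish. *)
Lemma diff_poly (c : int) n p : (size p <= n.+1)%N ->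
  exists q : {poly M},
    [/\ forall x, pfun q x = pfun p (x + c) - pfun p x, (size q <= n)%N
      & q`_n.-1 = (n%:Z * c)%:~R * p`_n].
Proof.
elim: n p => [|n IHn] p sp.
  exists 0; split=> [x||]; rewrite ?size_poly0 //; last by rewrite !mul0r coef0.
  by rewrite (size1_polyC sp) !pfunC subrr.
have pE := poly_take_drop 1 p; set r := drop_poly 1 p in pE.
have sr : (size r <= n.+1)%N by rewrite size_drop_poly leq_subLR.
have tE : take_poly 1 p = ((take_poly 1 p)`_0)%:P.
  by apply: size1_polyC; exact: size_take_poly.
have rE k : r`_k = p`_k.+1 by rewrite coef_drop_poly addn1.
(* Here a is the constant coefficient [(take_poly 1 p)`_0]. *)
have pX x : pfun p x = (take_poly 1 p)`_0 + pfun r x *m x%:~R.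
  by rewrite -[in LHS]pE pfunD pfunM [in LHS]tE pfunC [pfun 'X^1 x]hornerX.
have [q [qx sq qn]] := IHn r sr.
exists (q * ('X + (c%:~R)%:P) + r * (c%:~R)%:P); split.
- move=> x; rewrite pfunD !pfunM pfunD pfunC !pX qx [pfun 'X x]hornerX.
  rewrite opprD addrACA subrr add0r mulmxBl !intrD !mulmxDr.
  by rewrite opprD addrA subrK.
- rewrite (leq_trans (size_polyD _ _)) // geq_max; apply/andP; split.
    rewrite (leq_trans (size_polyMleq _ _)) // size_XaddC addn2 /=.
    by rewrite ltnS.
  rewrite (leq_trans (size_polyMleq _ _)) // -subn1 leq_subLR addnC.
  by apply: leq_add => //; exact: size_polyC_leq1.
- rewrite coefD coefMC mulrDr coefD coefMC coefMX rE [q`_n]nth_default //.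
  rewrite mul0r addr0 qn rE; case: n {IHn sp sr rE pX sq qn} => [|n] /=.
    by rewrite add0r mul1r; exact: commr_int.
  rewrite [_ * c%:~R]commr_int -mulrDl -intrD; congr (_%:~R * _).
  by rewrite -[X in _ + X]mul1r -mulrDl addrC -intS.
Qed.

(** * Convergence of the series defining the inner product *)

Implicit Types (W F G : int -> M).

(** In finite dimension, linear maps are finite combinations of coordinates. *)
Lemma continuous_mulmx2 A B : continuous (fun X : M => A *m X *m B).
Proof.
have -> : (fun X : M => A *m X *m B) =
    (fun X : M => \sum_i \sum_j X i j *: (A *m delta_mx i j *m B)).
  apply/funext => X; rewrite {1}[X]matrix_sum_delta mulmx_sumr mulmx_suml.
  apply: eq_bigr => i _; rewrite mulmx_sumr mulmx_suml; apply: eq_bigr => j _.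
  by rewrite -scalemxAr -scalemxAl.
apply: continuous_big => [|i _]; first exact: add_continuous.
apply: continuous_big => [|j _]; first exact: add_continuous.
move=> X; apply: (@cvgZr_tmp _ _ _ (nbhs X)).
exact: (@coord_continuous C _ _ i j X).
Qed.

Lemma cvg_series_mulmx2 A B (u : nat -> M) : cvgn (series u) ->
  series (fun x => A *m u x *m B) @ \oo --> A *m limn (series u) *m B.
Proof.
move=> cu; have -> : series (fun x => A *m u x *m B) =
    (fun X : M => A *m X *m B) \o series u.
  by apply/funext => n; rewrite /series /= mulmx_sumr mulmx_suml.
by apply: continuous_cvg; [exact: continuous_mulmx2 | exact: cu].
Qed.

Lemma cvg_seriesD (u v : nat -> M) (a b : M) :
  series u @ \oo --> a -> series v @ \oo --> b ->
  series (fun x => u x + v x) @ \oo --> a + b.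
Proof.
move=> cu cv; have -> : series (fun x => u x + v x) = series u + series v.
  by apply/funext => n; rewrite /series /= big_split.
exact: cvgD.
Qed.

Lemma is_cvg_series_sum n (u : 'I_n -> nat -> M) :
  (forall i, cvgn (series (u i))) -> cvgn (series (fun x => \sum_i u i x)).
Proof.
elim: n u => [|n IHn] u cu.
  have -> : series (fun x => \sum_i u i x) = cst 0.
    by apply/funext => n; rewrite /series /= big1 // => k _; rewrite big_ord0.
  exact: is_cvg_cst.
under eq_fun do rewrite big_ord_recl.
apply/cvg_ex; eexists; apply: cvg_seriesD; first exact: cu.
by apply: IHn => i; exact: cu.
Qed.

Definition inner_term W F G (x : nat) : M := F x%:Z *m W x%:Z *m (G x%:Z)^t*.

(** Expanding both polynomials presents the series as a finite combination of
    the moment series, multiplied on both sides by constant matrices.  So finite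
    moments suffice, without absolute convergence or completeness. *)
Lemma is_cvg_inner W p q : finite_moments W ->
  cvgn (series (inner_term W (pfun p) (pfun q))).
Proof.
move=> mW.
have -> : inner_term W (pfun p) (pfun q) = fun x : nat =>
    \sum_(i < size p) \sum_(j < size (padj q))
      p`_i *m (x%:R ^+ (i + j) *: W x%:Z) *m (padj q)`_j.
  apply/funext => x; rewrite /inner_term conj_pfun !(pfun_sum _ _ _ (leqnn _)).
  rewrite !mulmx_suml; apply: eq_bigr => i _; rewrite mulmx_sumr.
  apply: eq_bigr => j _; rewrite exprD.
  by rewrite -!scalemxAl -!scalemxAr -!scalemxAl scalerA mulrC.
apply: is_cvg_series_sum => i; apply: is_cvg_series_sum => j.
by apply/cvg_ex; eexists; apply: cvg_series_mulmx2; exact: mW.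
Qed.

Lemma cvg_inner W p q : finite_moments W ->
  series (inner_term W (pfun p) (pfun q)) @ \oo --> inner W (pfun p) (pfun q).
Proof. by move=> mW; exact: is_cvg_inner. Qed.

Lemma inner_lim W F G (L : M) :
  series (inner_term W F G) @ \oo --> L -> inner W F G = L.
Proof. by apply: cvg_lim; exact: norm_hausdorff. Qed.

(** * The matrix valued inner product *)

Section Sesquilinearity.
Variable W : int -> M.
Hypothesis mW : finite_moments W.
Local Notation ip p q := (inner W (pfun p) (pfun q)).

Lemma innerDl p q r : ip (p + q) r = ip p r + ip q r.
Proof.
apply: inner_lim; have -> : inner_term W (pfun (p + q)) (pfun r) = fun x =>
    inner_term W (pfun p) (pfun r) x + inner_term W (pfun q) (pfun r) x.
  by apply/funext => x; rewrite /inner_term pfunD !mulmxDl.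
by apply: cvg_seriesD; exact: cvg_inner.
Qed.

Lemma innerDr p q r : ip r (p + q) = ip r p + ip r q.
Proof.
apply: inner_lim; have -> : inner_term W (pfun r) (pfun (p + q)) = fun x =>
    inner_term W (pfun r) (pfun p) x + inner_term W (pfun r) (pfun q) x.
  by apply/funext => x; rewrite /inner_term pfunD conjmxD mulmxDr.
by apply: cvg_seriesD; exact: cvg_inner.
Qed.

Lemma innerCl A p q : ip (A%:P * p) q = A *m ip p q.
Proof.
apply: inner_lim; have -> : inner_term W (pfun (A%:P * p)) (pfun q) = fun x =>
    A *m inner_term W (pfun p) (pfun q) x *m 1%:M.
  by apply/funext => x; rewrite /inner_term pfunM pfunC mulmx1 !mulmxA.
rewrite -[X in _ --> X]mulmx1; apply: cvg_series_mulmx2; exact: is_cvg_inner.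
Qed.

Lemma innerCr A p q : ip p (A%:P * q) = ip p q *m A^t*.
Proof.
apply: inner_lim; have -> : inner_term W (pfun p) (pfun (A%:P * q)) = fun x =>
    1%:M *m inner_term W (pfun p) (pfun q) x *m A^t*.
  by apply/funext => x; rewrite /inner_term pfunM pfunC conjmxM mul1mx !mulmxA.
rewrite -[X in X *m _]mul1mx; apply: cvg_series_mulmx2; exact: is_cvg_inner.
Qed.

Lemma inner0l q : ip 0 q = 0.
Proof. by rewrite -[0](mul0r 0) -[X in X * _]/(0%:P) innerCl mul0mx. Qed.

Lemma inner0r p : ip p 0 = 0.
Proof.
by rewrite -[0](mul0r 0) -[X in X * _]/(0%:P) innerCr conjmx0 mulmx0.
Qed.

(** Strong induction on the degree: subtracting from q its top coefficient times
    some P_m with m < n leaves a polynomial of smaller degree. *)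
Lemma inner_MVOP_lower (P : nat -> {poly M}) n q : monic_MVOP W P ->
  (size q <= n)%N -> ip (P n) q = 0 /\ ip q (P n) = 0.
Proof.
move=> [mP oP].
have [b] := ubnP (size q); elim: b q => // b IHb q; rewrite ltnS => sq sn.
case: b IHb sq => [|m] IHm sq.
  by move: sq; rewrite leqn0 size_poly_eq0 => /eqP ->; rewrite inner0l inner0r.
have [mPm sPm] := mP m.
have [qm|mq] := ltnP (size q) m.+1; first by apply: IHm.
have mn : (m < n)%N by apply: leq_trans sn.
have [r [-> sr]] := poly_split_top _ _ _ mPm sPm sq.
have [|e1 e2] := IHm r sr; first exact: leq_trans (ltnW mn).
rewrite innerDl innerDr innerCl innerCr e1 e2 !oP ?mul0mx ?mulmx0 ?addr0 //.
  by rewrite neq_ltn mn.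
by rewrite neq_ltn mn orbT.
Qed.

End Sesquilinearity.

(** A partial sum dominates each of its terms, so a nonzero term would bound the
    norms of the partial sums away from 0; this uses comparisons between
    nonnegative elements only, hence works in a partially ordered field. *)
Lemma nonneg_series_cvg0 (u : nat -> C) : (forall n, 0 <= u n) ->
  series u @ \oo --> (0 : C) -> forall n, u n = 0.
Proof.
move=> u0 cu n; apply/eqP; apply: contraT => un.
have upos : 0 < u n by rewrite lt_def un u0.
have small : \forall k \near \oo, `|series u k| < u n.
  exact: cvgr0_norm_lt.
have [k [/= nk sk]] := filter_ex (filterI (nbhs_infty_gt n) small).
have : u n <= series u k.
  rewrite /series /= big_mkord (bigD1 (Ordinal nk)) //= lerDl.
  exact: sumr_ge0.
have s0 : 0 <= series u k by exact: sumr_ge0.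
by move: sk; rewrite /= ger0_norm // => sk /le_lt_trans/(_ sk); rewrite ltxx.
Qed.

(** Over a matrix ring a nonzero polynomial may have infinitely many roots; a
    bound by the degree holds for roots that commute and have invertible
    differences, such as distinct natural numbers. *)
Lemma poly_nat_roots_eq0 p : (forall x : nat, pfun p x = 0) -> p = 0.
Proof.
move=> p0; apply/eqP; apply: contraT => np.
pose rs : seq M := [seq x%:R | x <- iota 0 (size p)].
have ur : uniq_roots rs.
  rewrite /rs; elim: (size p) 0%N => //= k IHk m; rewrite IHk andbT.
  apply/allP => z /mapP[y]; rewrite mem_iota => /andP[my _] ->.
  rewrite /diff_roots; apply/andP; split; first by rewrite (commr_nat m%:R y).
  rewrite -natrB ?(ltnW my) // -scaler_nat scaler_unit ?unitr1 //.
  by rewrite unitfE pnatr_eq0 subn_eq0 -ltnNge.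
have ra : all (root p) rs.
  by apply/allP => _ /mapP[y _ ->]; rewrite /root -[X in _ == X](p0 y).
by have := max_ring_poly_roots np ra ur; rewrite size_map size_iota ltnn.
Qed.

Lemma form_rowE A B i :
  (B *m A *m B^t*) i i = (row i B *m A *m (row i B)^t*) 0 0.
Proof. by rewrite -row_mul !mxE; apply: eq_bigr => k _; rewrite !mxE. Qed.

Lemma posdef_form_eq0 A B :
  posdefmx A -> (forall i, (B *m A *m B^t*) i i = 0) -> B = 0.
Proof.
move=> [_ pA] B0; apply/row_matrixP => i; rewrite row0; apply/eqP.
by apply: contraT => /pA; rewrite -form_rowE B0 ltxx.
Qed.

Lemma posdef_form_ge0 A B i : posdefmx A -> 0 <= (B *m A *m B^t*) i i.
Proof.
move=> [_ pA]; rewrite form_rowE; have [->|/pA/ltW //] := eqVneq (row i B) 0.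
by rewrite !mul0mx mxE.
Qed.

(** Each diagonal entry of the inner product is a series of nonnegative terms.
    If it vanishes, positive definiteness of W(x) forces p(x) = 0 at every
    natural number x. *)
Lemma inner_self_eq0 W p : weight W -> inner W (pfun p) (pfun p) = 0 -> p = 0.
Proof.
move=> [pW _ mW] p0; apply: poly_nat_roots_eq0 => x.
apply: (posdef_form_eq0 _ _ (pW x)) => i.
pose u y := inner_term W (pfun p) (pfun p) y i i.
have u0 y : 0 <= u y by exact: posdef_form_ge0.
apply: (nonneg_series_cvg0 u u0 _ x).
have := cvg_inner W p p mW; rewrite p0 => cp.
have -> : series u =
    (fun X : M => X i i) \o series (inner_term W (pfun p) (pfun p)).
  by apply/funext => n; rewrite /series /= summxE.
rewrite (_ : 0 = (0 : M) i i); last by rewrite mxE.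
by apply: continuous_cvg; [exact: (@coord_continuous C _ _ i i 0) | exact: cp].
Qed.

(** * The two shift operators *)

Lemma Delta_poly n p : (size p <= n.+1)%N -> exists q : {poly M},
  [/\ Delta (pfun p) = pfun q, (size q <= n)%N & q`_n.-1 = n%:R *: p`_n].
Proof.
move=> /(diff_poly 1)[q [qE sq qn]]; exists q; split=> //.
  by apply/funext => x; rewrite qE.
by rewrite qn mulr1 -pmulrn mulr_natl scaler_nat.
Qed.

(** The operator S raises the degree by at most one, since it is
    Q |-> (Q(x-1) - Q(x)) Phi(x)^* - Q(x-1) Psi(x)^*, where the first factor has
    lost a degree and Phi, Psi have degrees 2 and 1.  The bound n on the size
    is one more than the degree, which is why the factor n - 1 appears. *)
Lemma Sop_poly (Phi Psi : {poly M}) n q :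
  (size Phi <= 3)%N -> (size Psi <= 2)%N -> (size q <= n)%N ->
  exists s : {poly M}, [/\ Sop Phi Psi (pfun q) = pfun s, (size s <= n.+1)%N
    & s`_n = - (n.-1%:R *: (q`_n.-1 *m (Phi`_2)^t*)) - q`_n.-1 *m (Psi`_1)^t*].
Proof.
move=> /size_padj sPhi /size_padj sPsi; case: n => [|n] sq.
  move: sq; rewrite leqn0 size_poly_eq0 => /eqP ->; exists 0.
  rewrite size_poly0 coef0 scale0r mul0mx oppr0 addr0; split=> //.
  apply/funext => x; rewrite /Sop /rmulop /nabla /eta_pow !pfunC.
  by rewrite subrr !mul0mx addr0 oppr0.
have [d [dE sd dn]] := diff_poly (-1) _ _ sq.
have sqd : (size (q + d)%R <= n.+1)%N.
  by rewrite (leq_trans (size_polyD _ _)) // geq_max sq (leq_trans sd).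
exists (d * padj Phi - (q + d) * padj Psi); split.
- apply/funext => x; rewrite pfunB !pfunM pfunD dE /Sop /rmulop /nabla /eta_pow.
  by rewrite [pfun q x + (_ - _)]addrC subrK opprD -mulNmx opprB.
- rewrite (leq_trans (size_polyD _ _)) // size_polyN geq_max; apply/andP; split.
    by rewrite -addn2; exact: size_polyM_le.
  by rewrite -[n.+2]addn1; exact: size_polyM_le.
rewrite coefB; congr (_ - _).
  move: dn sd {sqd}; case: n sq => [|k] sq /= dn sd.
    move: sd; rewrite leqn0 size_poly_eq0 => /eqP ->.
    by rewrite mul0r coef0 scale0r oppr0.
  rewrite -[in LHS](addn2 k) coefM_top //.
  rewrite dn coef_padj mulrN1 intrN mulNr -pmulrn mulr_natl -scaler_nat.
  by rewrite mulNr scalerAl.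
rewrite -[in LHS](addn1 n) coefM_top // ?coef_padj.
by rewrite coefD [d`_n]nth_default ?addr0.
Qed.

(** Summation by parts.  The two Pearson equations give
    W (Phi - Psi) = W'(x-1), so that S transfers the weight W into
    differences of W'.  The partial sums of the two sides then differ by the
    boundary term T n = P(n) W'(n-1) Q(n-1)^*.  It vanishes at n = 0 because
    W'(-1) = 0, and tends to 0 because T n.+1 is the general term of the
    convergent series for the inner product of P(x+1) and Q. *)
Lemma inner_Delta_Sop W W' (Phi Psi p q : {poly M}) :
  finite_moments W' -> W' (-1) = 0 ->
  (forall x, W' x = W x *m pfun Phi x) ->
  (forall x, nabla W' x = W x *m pfun Psi x) ->
  inner W' (Delta (pfun p)) (pfun q) = inner W (pfun p) (Sop Phi Psi (pfun q)).
Proof.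
move=> mW' W'N1 WPhi WPsi.
have [d [dE _ _]] := Delta_poly _ _ (leqW (leqnn (size p))).
have dpE x : pfun p (x + 1) = pfun (p + d) x.
  by rewrite pfunD -dE /Delta [in RHS]addrC subrK.
have adjK (r : {poly M}) (x : nat) : (pfun (padj r) x)^t* = pfun r x.
  by rewrite conj_pfun padjK.
pose T (n : nat) := pfun p n *m W' (n%:Z - 1) *m (pfun q (n%:Z - 1))^t*.
have WS (x : nat) : W x *m (Sop Phi Psi (pfun q) x)^t* =
    W' (x%:Z - 1) *m (pfun q (x%:Z - 1))^t* - W' x *m (pfun q x)^t*.
  have -> : W' (x%:Z - 1) = W x *m (pfun Phi x - pfun Psi x).
    by rewrite mulmxBr -WPhi -WPsi /nabla opprB [in RHS]addrC subrK.
  rewrite WPhi -!mulmxA -mulmxBr; congr (_ *m _).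
  rewrite /Sop /rmulop /nabla /eta_pow -(adjK Phi) -(adjK Psi).
  set A := pfun (padj Phi) x; set B := pfun (padj Psi) x.
  set Q := pfun q x; set Q' := pfun q (x%:Z - 1).
  rewrite conjmxN conjmxD !conjmxM conjmxB mulmxBr mulmxBl.
  by rewrite opprD opprB addrAC.
have SZ (n : nat) : n.+1%:Z = n%:Z + 1 by rewrite intS addrC.
have TE n : series (inner_term W (pfun p) (Sop Phi Psi (pfun q))) n =
    series (inner_term W' (Delta (pfun p)) (pfun q)) n - T n.
  rewrite /series /=; elim: n => [|n IHn].
    by rewrite !big_geq // /T [_ - 1]sub0r W'N1 mulmx0 mul0mx subr0.
  rewrite !big_nat_recr //= IHn {IHn} -!addrA; congr (_ + _).
  rewrite /inner_term -mulmxA WS /T.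
  rewrite SZ addrK /Delta mulmxBr !mulmxA addKr !mulmxBl.
  by rewrite addrAC subrr sub0r.
have T0 : T @ \oo --> (0 : M).
  rewrite -cvg_shiftS.
  have -> : (fun n => T n.+1) = inner_term W' (pfun (p + d)) (pfun q).
    apply/funext => n; rewrite /T /inner_term.
    by rewrite -dpE SZ addrK.
  by apply: cvg_series_cvg_0; exact: is_cvg_inner.
symmetry; apply: inner_lim.
rewrite -[X in _ --> X]subr0 dE.
rewrite (_ : series _ = series (inner_term W' (pfun d) (pfun q)) - T).
  by apply: cvgB => //; exact: cvg_inner.
by apply/funext => n; rewrite TE dE.
Qed.

Lemma L2_pfun W p : weight W -> L2 W (pfun p).
Proof. by move=> [_ _ mW]; exact: is_cvg_inner. Qed.

(** A single step from l to l + 1, with W, P and W', P' standing for the weights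
    and polynomials at l and l + 1. *)
Section PearsonPair.
Variables (W W' : int -> M) (Phi Psi : {poly M}) (P P' : nat -> {poly M}).
Hypotheses (wW : weight W) (wW' : weight W').
Hypotheses (oP : monic_MVOP W P) (oP' : monic_MVOP W' P').
Hypotheses (sPhi : (size Phi <= 3)%N) (sPsi : (size Psi <= 2)%N).
Hypotheses (WPhi : forall x, W' x = W x *m pfun Phi x)
           (WPsi : forall x, nabla W' x = W x *m pfun Psi x).

Let mW : finite_moments W. Proof. by case: wW. Qed.
Let mW' : finite_moments W'. Proof. by case: wW'. Qed.

Lemma Delta_Sop_adjoint p q :
  inner W' (Delta (pfun p)) (pfun q) = inner W (pfun p) (Sop Phi Psi (pfun q)).
Proof. by apply: inner_Delta_Sop => //; case: wW' => _ /(_ (-1)) ->. Qed.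

(** The difference of P_(n+1) has degree at most n and top coefficient n+1;
    let r be what remains after removing (n+1) P'_n.  As r S has degree at most
    n, the adjoint relation gives <P_(n+1) Delta, r>' = <P_(n+1), r S> = 0, and
    P'_n is orthogonal to r as well, so <r, r>' = 0. *)
Lemma Delta_MVOP n x : Delta (pfun (P n)) x = n%:R *: pfun (prevP P' n) x.
Proof.
have [mP sP] := oP.1 n; have sPn : (size (P n) <= n.+1)%N by rewrite sP.
have Pn : (P n)`_n = 1 by have := monicP mP; rewrite /lead_coef sP.
case: n mP sP sPn Pn => [|n] mP sP sPn Pn.
  by rewrite scale0r /Delta /pfun (size1_polyC sPn) !hornerC subrr.
have [d [dE sd dn]] := Delta_poly _ _ sPn.
have [mP' sP'] := oP'.1 n.
have [r [dr sr]] := poly_split_top _ _ _ mP' sP' sd.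
have r0 : r = 0.
  apply: (inner_self_eq0 _ _ wW').
  have [s [sE ss _]] := Sop_poly _ _ _ _ sPhi sPsi sr.
  have := Delta_Sop_adjoint (P n.+1) r; rewrite dE sE.
  rewrite (inner_MVOP_lower _ mW _ _ _ oP ss).1 dr innerDl // innerCl //.
  by rewrite (inner_MVOP_lower _ mW' _ _ _ oP' sr).1 mulmx0 add0r.
rewrite dE dr r0 addr0 pfunM pfunC dn Pn /=.
by rewrite -scalemxAl mul1mx.
Qed.

(** The mirror image of the previous argument: if r is what remains of the image
    of P'_n after removing its top coefficient times P_(n+1), then
    <r, P'_n S> = <r Delta, P'_n>' = 0 because the difference of r has degree
    less than n. *)
Lemma Sop_MVOP n x : Sop Phi Psi (pfun (P' n)) x =
  (- (n%:R *: (Phi`_2)^t*) - (Psi`_1)^t*) *m pfun (P n.+1) x.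
Proof.
have [mP' sP'] := oP'.1 n; have sPn : (size (P' n) <= n.+1)%N by rewrite sP'.
have Pn : (P' n)`_n = 1 by have := monicP mP'; rewrite /lead_coef sP'.
have [s [sE ss sn]] := Sop_poly _ _ _ _ sPhi sPsi sPn.
have [mP sP] := oP.1 n.+1.
have [r [rE sr]] := poly_split_top _ _ _ mP sP ss.
have r0 : r = 0.
  apply: (inner_self_eq0 _ _ wW).
  have [d [dE sd _]] := Delta_poly _ _ sr.
  have := Delta_Sop_adjoint r (P' n); rewrite dE sE.
  rewrite (inner_MVOP_lower _ mW' _ _ _ oP' sd).2 rE innerDr // innerCr //.
  by rewrite (inner_MVOP_lower _ mW _ _ _ oP sr).2 mul0mx add0r.
rewrite sE rE r0 addr0 pfunM pfunC sn /= Pn.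
by rewrite !mul1mx.
Qed.

End PearsonPair.

End ShiftOperators.

(** * The theorem *)

Theorem theorem2p8 (R : realType) (N : nat) (V : set nat)
    (W : nat -> int -> 'M[R[i]]_N.+1)
    (P : nat -> nat -> {poly 'M[R[i]]_N.+1})
    (Phi Psi : nat -> {poly 'M[R[i]]_N.+1})
    (K2 K1 K0 J1 J0 : nat -> 'M[R[i]]_N.+1)
    (Vconsecutive : consecutive V)
    (Vtwo : exists a b : nat, [/\ V a, V b & a != b])
    (Wweight : forall l : nat, V l -> weight (W l))
    (PMVOP : forall l : nat, V l -> monic_MVOP (W l) (P l))
    (degPhi : forall l : nat, without_max V l -> (size (Phi l) <= 3)%N)
    (degPsi : forall l : nat, without_max V l -> (size (Psi l) <= 2)%N)
    (PhiE : forall l : nat, without_max V l ->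
      Phi l = (K2 l)%:P * 'X^2 + (K1 l)%:P * 'X + (K0 l)%:P)
    (PsiE : forall l : nat, without_max V l ->
      Psi l = (J1 l)%:P * 'X + (J0 l)%:P)
    (WPhi : forall l : nat, without_max V l -> forall x : int,
      W l.+1 x = W l x *m pfun (Phi l) x)
    (WPsi : forall l : nat, without_max V l -> forall x : int,
      nabla (W l.+1) x = W l x *m pfun (Psi l) x) :
  forall l : nat, without_max V l ->
  [/\ (* (1) *)
      poly_operator (W l) (W l.+1) (@Delta R[i] N) /\
      (forall (n : nat) (x : int),
        Delta (pfun (P l n)) x = n%:R *: pfun (prevP (P l.+1) n) x),
      (* (2) *)
      [/\ forall (Q : int -> 'M[R[i]]_N.+1) (x : int),
            Sop (Phi l) (Psi l) Q x =
            - (Q x *m pfun (padj (Phi l)) x) +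
            rmulop (eta_pow (-1))
              (fun y => pfun (padj (Phi l)) y - pfun (padj (Psi l)) y) Q x,
          poly_operator (W l.+1) (W l) (Sop (Phi l) (Psi l))
        & forall p q : {poly 'M[R[i]]_N.+1},
            inner (W l.+1) (Delta (pfun p)) (pfun q) =
            inner (W l) (pfun p) (Sop (Phi l) (Psi l) (pfun q))]
    & (* (3) *)
      forall (n : nat) (x : int), (1 <= n)%N ->
        Sop (Phi l) (Psi l) (pfun (P l.+1 n.-1)) x =
        (- ((n%:R - 1) *: (K2 l)^t*) - (J1 l)^t*) *m pfun (P l n) x].
Proof.
move=> l Vl.
(* Some element of V lies above l, so l + 1 belongs to V by consecutivity. *)
have Vl1 : V l.+1.
  have [VVl nub] := Vl.
  have [b /not_implyP[Vb /negP]] := (existsNP _).2 nub.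
  by rewrite -ltnNge => lb; apply: (Vconsecutive _ _ _ VVl Vb); rewrite leqnSn.
have wl := Wweight l Vl.1; have wl1 := Wweight l.+1 Vl1.
have ol := PMVOP l Vl.1; have ol1 := PMVOP l.+1 Vl1.
have adj := Delta_Sop_adjoint _ _ _ _ _ _ wl1 (WPhi l Vl) (WPsi l Vl).
have Phi2 : (Phi l)`_2 = K2 l.
  by rewrite PhiE // !coefD !coefCM coefXn coefX coefC /= mulr1 mulr0 !addr0.
have Psi1 : (Psi l)`_1 = J1 l.
  by rewrite PsiE // !coefD !coefCM coefX coefC /= mulr1 addr0.
split.
- split=> [p|n x].
    have [q [qE _ _]] := Delta_poly _ _ _ _ (leqW (leqnn (size p))).
    split; first exact: L2_pfun.
    by exists q; rewrite qE; split=> //; exact: L2_pfun.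
  exact: (Delta_MVOP _ _ _ _ _ _ _ _ wl wl1 ol ol1 (degPhi l Vl) (degPsi l Vl)
            (WPhi l Vl) (WPsi l Vl)).
- split=> [Q x|p|//].
    rewrite /Sop /rmulop /nabla /eta_pow mulmxBl mulmxBr.
    by rewrite opprD opprB [_ - Q x *m _]addrC -addrA.
  have [q [qE _ _]] :=
    Sop_poly _ _ _ _ _ _ (degPhi l Vl) (degPsi l Vl) (leqnn (size p)).
  by split; [exact: L2_pfun | exists q; rewrite qE; split=> //; exact: L2_pfun].
- move=> [//|n] x _ /=.
  rewrite (Sop_MVOP _ _ _ _ _ _ _ _ wl wl1 ol ol1 (degPhi l Vl) (degPsi l Vl)
            (WPhi l Vl) (WPsi l Vl)) Phi2 Psi1.
  by rewrite -natr1 addrK.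
Qed.
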